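(* Let $B$ be a unital $\mathbb K$-algebra. For $F,G\in G_B^{\mathrm{inv}}$ we have $$F\rhd G=F\rhd_l\big(S^l(F)\rhd_r G\big),\qquad F\rhd' G=F\rhd_r\big(S^r(F)\rhd_l G\big).$$ Therefore $$F\bullet G=\big(S^l(G)\rhd_r F\big)\star_l G,\qquad F\bullet' G=\big(S^r(G)\rhd_l F\big)\star_r G .$$
   Context: $\mathbb K$ is a field of characteristic zero. For a unital $\mathbb K$-algebra $B$, $\mathrm{Mult}[[B]]$ is the set of sequences $f=(f_n)_{n\ge0}$ of $\mathbb K$-multilinear maps $f_n:B^{\otimes n}\to B$ (with $B^{\otimes 0}=\mathbb K$, so $f_0$ is identified with an element of $B$). Product: $(f\cdot g)_n(x_1,\dots,x_n)=\sum_{k=0}^n f_k(x_1,\dots,x_k)\,g_{n-k}(x_{k+1},\dots,x_n)$, also written $fg$, with unit $1=(\delta_{n,0}1)_n$. Composition, when $g_0=0$: $(f\circ g)_n(x_1,\dots,x_n)=\sum_{l\ge0}\sum_{k_1+\cdots+k_l=n,\,k_i\ge1}f_l\big(g_{k_1}(x_1,\dots,x_{k_1}),\dots,g_{k_l}(x_{n-k_l+1},\dots,x_n)\big)$, with unit $I=(\delta_{n,1}\mathrm{Id})_n$. Composition takes precedence over multiplication: $f\cdot g\circ h\cdot k=f\cdot(g\circ h)\cdot k$. $G_B^{\mathrm{inv}}=\{f: f_0\in B^\times\}$ is a group for $\cdot$, with inverse $f^{-1}$; $G_B^{\mathrm{dif}}=\{f: f_0=0,\ f_1\in \mathrm{GL}(B)\}$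 is a group for $\circ$, with inverse $f^{\circ-1}$. For $F,G\in G_B^{\mathrm{inv}}$: $F\rhd_l G:=G\circ(IF)$, $F\rhd_r G:=G\circ(FI)$, $F\rhd G:=G\circ(F^{-1}IF)$, $F\rhd' G:=G\circ(FIF^{-1})$; $F\star_l G:=G\cdot F\circ(IG)$, $F\star_r G:=F\circ(GI)\cdot G$, $F\bullet G:=G\cdot F\circ(G^{-1}IG)$, $F\bullet' G:=F\circ(GIG^{-1})\cdot G$; $S^l(F):=F^{-1}\circ(IF)^{\circ-1}$, $S^r(F):=F^{-1}\circ(FI)^{\circ-1}$ (equivalently $I\cdot S^l(F)=(IF)^{\circ-1}$ and $S^r(F)\cdot I=(FI)^{\circ-1}$). *)

(* Defs.v *)
From mathcomp Require Import all_boot all_algebra.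
From Stdlib Require Import ClassicalEpsilon.

Set Implicit Arguments.
Unset Strict Implicit.
Unset Printing Implicit Defensive.

Import GRing.Theory.
Local Open Scope ring_scope.

Declare Scope mult_scope.
Delimit Scope mult_scope with mult.

Section Mult.

Variables (K : fieldType) (B : algType K).

(* A sequence (f_n)_n of maps B^n -> B; multilinearity is the separate predicate
   is_mult, so that Mult[[B]] is the subset of families satisfying it. *)
Definition multfam := forall n : nat, n.-tuple B -> B.

Implicit Types f g h F G : multfam.

(* f_n (x_1, ..., x_n), with n read off from the list of arguments. *)
Definition ev f (s : seq B) : B := f (size s) (in_tuple s).

Definition upd n (x : n.-tuple B) (i : 'I_n) (u : B) : n.-tuple B :=
  [tuple if j == i then u else tnth x j | j < n].

Definition is_mult f : Prop :=
  forall n (x : n.-tuple B) (i : 'I_n), linear (fun u : B => f n (upd x i u)).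

Definition munit : multfam := fun n _ => (n == 0%N)%:R.

Definition Id : multfam := fun n x => if n == 1%N then head 0 x else 0.

Definition mmul f g : multfam := fun n x =>
  \sum_(k < n.+1) ev f (take k x) * ev g (drop k x).

(* The sum over l >= 0 is cut at l = n: there is no (k_1, ..., k_l) with
   k_i >= 1 and k_1 + ... + k_l = n when l > n. Since k_i >= 1, the component
   g_0 never occurs; the operation is only meant for g_0 = 0. *)
Definition mcomp f g : multfam := fun n x =>
  \sum_(l < n.+1)
    \sum_(k : l.-tuple 'I_n.+1 |
            all (leq 1) (map val k) && (sumn (map val k) == n))
      ev f [seq ev g y | y <- reshape (map val k) x].

Definition invertible (b : B) : Prop := exists c : B, c * b = 1 /\ b * c = 1.

Definition Ginv f : Prop := is_mult f /\ invertible (ev f [::]).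

Definition Gdif f : Prop :=
  [/\ is_mult f, ev f [::] = 0 & bijective (fun u : B => ev f [:: u])].

(* Inverses in the groups Ginv and Gdif; the values outside these groups are
   irrelevant. *)
Definition mmul_inv f : multfam :=
  epsilon (inhabits munit)
    (fun h => [/\ Ginv h, mmul f h = munit & mmul h f = munit]).

Definition mcomp_inv f : multfam :=
  epsilon (inhabits Id)
    (fun h => [/\ Gdif h, mcomp f h = Id & mcomp h f = Id]).

End Mult.

Arguments Id {K B} n x.
Arguments munit {K B} n x.

Infix "⋅" := mmul (at level 40, left associativity) : mult_scope.
Infix "∘" := mcomp (at level 35, right associativity) : mult_scope.
Notation "f '^⋅-1'" := (mmul_inv f)
  (at level 2, left associativity, format "f '^⋅-1'") : mult_scope.
Notation "f '^∘-1'" := (mcomp_inv f)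
  (at level 2, left associativity, format "f '^∘-1'") : mult_scope.

Section Operations.

Local Open Scope mult_scope.

Variables (K : fieldType) (B : algType K).

Implicit Types F G : multfam B.

Definition rhd_l F G : multfam B := G ∘ (Id ⋅ F).
Definition rhd_r F G : multfam B := G ∘ (F ⋅ Id).
Definition rhd F G : multfam B := G ∘ (F^⋅-1 ⋅ Id ⋅ F).
Definition rhd' F G : multfam B := G ∘ (F ⋅ Id ⋅ F^⋅-1).

Definition star_l F G : multfam B := G ⋅ F ∘ (Id ⋅ G).
Definition star_r F G : multfam B := F ∘ (G ⋅ Id) ⋅ G.
Definition bullet F G : multfam B := G ⋅ F ∘ (G^⋅-1 ⋅ Id ⋅ G).
Definition bullet' F G : multfam B := F ∘ (G ⋅ Id ⋅ G^⋅-1) ⋅ G.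

Definition Sl F : multfam B := F^⋅-1 ∘ (Id ⋅ F)^∘-1.
Definition Sr F : multfam B := F^⋅-1 ∘ (F ⋅ Id)^∘-1.

End Operations.

(* Main.v *)
Require Import Defs.
From mathcomp Require Import all_boot all_algebra.
From mathcomp Require Import zify.
From Stdlib Require Import FunctionalExtensionality ClassicalEpsilon.

(** Three facts give the identities.  Composition is associative as soon as its
    leftmost factor is multilinear; it distributes over a product in its left
    argument, (f ⋅ g) ∘ h = (f ∘ h) ⋅ (g ∘ h); and S^l(F) ∘ (I ⋅ F) = F^-1, by
    associativity and the defining property of (I ⋅ F)^∘-1.  Hence
      F ▷_l (S^l(F) ▷_r G) = (G ∘ (S^l(F) ⋅ I)) ∘ (I ⋅ F)
                           = G ∘ ((S^l(F) ∘ (I ⋅ F)) ⋅ (I ⋅ F))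
                           = G ∘ (F^-1 ⋅ I ⋅ F) = F ▷ G,
    and symmetrically for ▷'.  The identities for • and •' follow by
    multiplying by G the first two with F and G exchanged.

    All this takes place in the two groups, so the group laws and the existence
    of inverses have to be established.  A family is read as one function on
    lists of arguments (ev).  The product is then the convolution splitsum over
    all ways to cut a list in two, and the composition is the sum blocksum over
    all ways to cut a list into consecutive nonempty blocks.  Both are
    structurally recursive, and the bridge between them is blocksum_cons: a
    segmentation of a nonempty list is a cut into a first block and a
    segmentation of the rest.  Together with coassociativity of cutting
    (splitsumA) it yields distributivity (blocksum_splitsum) and then
    associativity (blocksumA) by induction on the length of the list.

    Inverses: both equations f ⋅ h = 1 and f ∘ h = I determine h on a list from
    its values on shorter lists, so right inverses are fixpoints of contracting
    operators (mlin_fixpoint).  A right inverse that itself has a right inverse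
    is two-sided. *)

Set Implicit Arguments.
Unset Strict Implicit.
Unset Printing Implicit Defensive.
Import GRing.Theory.
Local Open Scope ring_scope.

(** * Sums over cuts and segmentations of a list *)

Section Sums.

Fixpoint splitsum (T : Type) (V : nmodType) (P : seq T -> seq T -> V) s : V :=
  if s is x :: t then P [::] s + splitsum (fun u v => P (x :: u) v) t
  else P [::] [::].

(** The list p is the beginning of a block that is still open: the next letter
    either joins it, or closes it and starts a new one.  Values of f on the
    closed blocks are stored by currying f, which keeps the recursion
    structural. *)
Fixpoint blocksum_from (T U : Type) (V : nmodType)
    (f : seq U -> V) (g : seq T -> U) (p t : seq T) : V :=
  if t is x :: t' then
    blocksum_from f g (rcons p x) t' +
    blocksum_from (fun w => f (g p :: w)) g [:: x] t'
  else f [:: g p].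

Definition blocksum (T U : Type) (V : nmodType)
    (f : seq U -> V) (g : seq T -> U) (s : seq T) : V :=
  if s is x :: t then blocksum_from f g [:: x] t else f [::].

Section Nmod.

Variables (T U : Type) (V : nmodType).
Implicit Types (P Q : seq T -> seq T -> V) (f : seq U -> V) (g : seq T -> U).

Lemma eq_splitsum P Q s :
  (forall u v, s = u ++ v -> P u v = Q u v) -> splitsum P s = splitsum Q s.
Proof.
elim: s P Q => [|x s IH] P Q PQ /=; first exact: PQ.
rewrite PQ //; congr (_ + _); by apply: IH => u v def_s; apply: PQ; rewrite def_s.
Qed.

Lemma splitsumD P Q s :
  splitsum (fun u v => P u v + Q u v) s = splitsum P s + splitsum Q s.
Proof. by elim: s P Q => //= x s IH P Q; rewrite IH addrACA. Qed.

Lemma splitsum_morph (W : nmodType) (phi : V -> W) P s :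
  {morph phi : a b / a + b} ->
  phi (splitsum P s) = splitsum (fun u v => phi (P u v)) s.
Proof. by move=> phiD; elim: s P => //= x s IH P; rewrite phiD IH. Qed.

(** Both sides sum over the cuts of s into three pieces. *)
Lemma splitsumA (P : seq T -> seq T -> seq T -> V) s :
  splitsum (fun u v => splitsum (fun u1 u2 => P u1 u2 v) u) s =
  splitsum (fun u v => splitsum (P u) v) s.
Proof.
elim: s P => //= x s IH P.
by rewrite splitsumD IH addrA.
Qed.

(** The marked letter y falls either into the right or into the left piece. *)
Lemma splitsum_cat_cons P s1 y s2 :
  splitsum P (s1 ++ y :: s2) =
  splitsum (fun u v => P u (v ++ y :: s2)) s1 +
  splitsum (fun u v => P (s1 ++ y :: u) v) s2.
Proof. by elim: s1 P => //= x s1 IH P; rewrite IH addrA. Qed.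

Lemma splitsumE P s :
  \sum_(k < (size s).+1) P (take k s) (drop k s) = splitsum P s.
Proof.
elim: s P => [|x s IH] P; first by rewrite big_ord_recl big_ord0 addr0.
by rewrite big_ord_recl /= -IH.
Qed.

Lemma blocksum_fromE f g p t :
  blocksum_from f g p t =
  splitsum (fun u v => blocksum (fun w => f (g (p ++ u) :: w)) g v) t.
Proof.
elim: t f p => [|x t IH] f p /=; first by rewrite cats0.
rewrite cats0 addrC; congr (_ + _); rewrite IH.
by apply: eq_splitsum => u v _; rewrite cat_rcons.
Qed.

(** Sorting segmentations by their first block; this is the form in which
    segmentations are handled by induction on the length. *)
Lemma blocksum_cons f g x t :
  blocksum f g (x :: t) =
  splitsum (fun u v => blocksum (fun w => f (g (x :: u) :: w)) g v) t.
Proof. exact: blocksum_fromE. Qed.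

Lemma eq_blocksum_from f f' g p t :
  (forall b w, f (b :: w) = f' (b :: w)) ->
  blocksum_from f g p t = blocksum_from f' g p t.
Proof.
elim: t f f' p => [|x t IH] f f' p ff' //=.
by congr (_ + _); apply: IH.
Qed.

Lemma eq_blocksum f f' g s : f =1 f' -> blocksum f g s = blocksum f' g s.
Proof. by case: s => //= x t ff'; apply: eq_blocksum_from. Qed.

(** There is always at least one block, so the value of f on the empty list
    does not occur. *)
Lemma blocksum_from0 f g p t :
  (forall b w, f (b :: w) = 0) -> blocksum_from f g p t = 0.
Proof.
by elim: t f p => [|x t IH] f p f0 //=; rewrite !IH // addr0.
Qed.

(** Only the segmentation with a single block survives. *)
Lemma blocksum_from1 f g p t :
  (forall a b w, f [:: a, b & w] = 0) ->
  blocksum_from f g p t = f [:: g (p ++ t)].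
Proof.
elim: t p => [|x t IH] p f2 /=; first by rewrite cats0.
by rewrite IH // blocksum_from0 // addr0 cat_rcons.
Qed.

Lemma blocksum_from_morph (W : nmodType) (phi : V -> W) f g p t :
  {morph phi : a b / a + b} ->
  phi (blocksum_from f g p t) = blocksum_from (fun w => phi (f w)) g p t.
Proof. by move=> phiD; elim: t f p => //= x t IH f p; rewrite phiD !IH. Qed.

Lemma blocksum_morph (W : nmodType) (phi : V -> W) f g s :
  {morph phi : a b / a + b} ->
  phi (blocksum f g s) = blocksum (fun w => phi (f w)) g s.
Proof. by case: s => //= x t phiD; apply: blocksum_from_morph. Qed.

Lemma blocksum_fromD f f' g p t :
  blocksum_from (fun w => f w + f' w) g p t =
  blocksum_from f g p t + blocksum_from f' g p t.
Proof. by elim: t f f' p => //= x t IH f f' p; rewrite !IH addrACA. Qed.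

Lemma blocksumD f f' g s :
  blocksum (fun w => f w + f' w) g s = blocksum f g s + blocksum f' g s.
Proof. by case: s => //= x t; apply: blocksum_fromD. Qed.

Lemma eq_blocksum_fromr f g g' p t :
  (forall s, (size s <= size p + size t)%N -> g s = g' s) ->
  blocksum_from f g p t = blocksum_from f g' p t.
Proof.
elim: t f p => [|x t IH] f p gg' /=; first by rewrite gg' ?addn0.
have le_t : (size t < (size t).+1)%N by [].
rewrite gg' ?leq_addr //; congr (_ + _); apply: IH => s les; apply: gg'.
  by rewrite /= addnS -addSn -(size_rcons p x).
by apply: leq_trans les _; rewrite /= add1n leq_addl.
Qed.

(** The whole list is a block only in the one-block segmentation, which is
    killed by the hypothesis on f. *)
Lemma eq_blocksum_fromr_lt f g g' p t :
  (0 < size p)%N -> (forall b, f [:: b] = 0) ->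
  (forall s, (size s < size p + size t)%N -> g s = g' s) ->
  blocksum_from f g p t = blocksum_from f g' p t.
Proof.
elim: t p => [|x t IH] p p_gt0 f1 gg' /=; first by rewrite !f1.
congr (_ + _).
  apply: IH => //; first by rewrite size_rcons.
  by move=> s lts; apply: gg'; rewrite /= addnS -addSn -(size_rcons p x).
rewrite gg' /=; last by rewrite -addSnnS leq_addr.
apply: eq_blocksum_fromr => s les; apply: gg'.
by apply: leq_ltn_trans les _; rewrite /= -[X in (X < _)%N]add0n ltn_add2r.
Qed.

End Nmod.

(** A segmentation of s followed by a cut of the list of its blocks is a cut
    of s followed by a segmentation of each piece.  With P u v = f u * g v this
    is distributivity of composition over the product; for general P it is the
    engine of associativity. *)
Lemma blocksum_splitsum (T U : Type) (V : nmodType)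
    (P : seq U -> seq U -> V) (g : seq T -> U) s :
  blocksum (splitsum P) g s =
  splitsum (fun u v => blocksum (fun u' => blocksum (P u') g v) g u) s.
Proof.
have [n] := ubnP (size s); elim: n P s => // n IH P [|x t] //= lt_t_n.
rewrite blocksum_fromE [X in _ = X + _]blocksum_fromE /=.
(* The first g-block x :: u belongs to the second piece of the cut, which then
   has an empty first piece, or to the first piece. *)
transitivity (
  splitsum (fun u v => blocksum (fun w => P [::] (g (x :: u) :: w)) g v) t +
  splitsum (fun u v => splitsum (fun v1 v2 =>
    blocksum (fun u' => blocksum (P (g (x :: u) :: u')) g v2) g v1) v) t).
  rewrite -splitsumD; apply: eq_splitsum => u v def_t.
  rewrite blocksumD IH //; by move: lt_t_n; rewrite /= def_t size_cat; lia.
congr (_ + _); rewrite -splitsumA; apply: eq_splitsum => u v _.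
by rewrite blocksum_fromE.
Qed.

(** The value of blocksum f g on a nonempty list is a splitsum, by cutting off
    the first g-block, so blocksum_splitsum moves h inside; additivity of f in
    its first slot then reassembles the first block of the right-hand side. *)
Lemma blocksumA (T U : Type) (V X : nmodType)
  (f : seq X -> V) (g : seq U -> X) (h : seq T -> U) s :
  (forall s1 s2, {morph (fun y => f (s1 ++ y :: s2)) : a b / a + b}) ->
  blocksum (blocksum f g) h s = blocksum f (blocksum g h) s.
Proof.
have [n] := ubnP (size s); elim: n f s => // n IH f [|x t] // lt_t_n fD.
rewrite !blocksum_cons.
(* x :: u is the first h-block, and v1 the rest of the first g-block. *)
transitivity (splitsum (fun u v => splitsum (fun v1 v2 =>
  blocksum (fun w => f (blocksum (fun w1 => g (h (x :: u) :: w1)) h v1 :: w))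
    (blocksum g h) v2) v) t).
  apply: eq_splitsum => u v def_t.
  under eq_blocksum do rewrite blocksum_cons.
  rewrite blocksum_splitsum; apply: eq_splitsum => v1 v2 def_v.
  have lt_v2 : (size v2 < n)%N.
    by move: lt_t_n; rewrite /= def_t def_v !size_cat; lia.
  pose phi y := blocksum (fun w => f (y :: w)) (blocksum g h) v2.
  rewrite -[RHS]/(phi _) blocksum_morph; last first.
    move=> a b; rewrite /phi -blocksumD; apply: eq_blocksum => w.
    exact: (fD [::]).
  apply: eq_blocksum => w; rewrite /phi IH // => s1 s2; exact: (fD (_ :: s1)).
rewrite -splitsumA; apply: eq_splitsum => u v def_t.
rewrite blocksum_cons.
pose phi y := blocksum (fun w => f (y :: w)) (blocksum g h) v.
rewrite -[RHS]/(phi _) splitsum_morph // => a b; rewrite /phi -blocksumD.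
by apply: eq_blocksum => w; exact: (fD [::]).
Qed.

(** The compositions of p + n whose first part is at least p: the shapes of the
    segmentations enumerated by blocksum_from when p letters are in the open
    block and n letters remain. *)
Fixpoint compositions_from p n : seq (seq nat) :=
  if n is n'.+1 then
    compositions_from p.+1 n' ++ map (cons p) (compositions_from 1 n')
  else [:: [:: p]].

Definition compositions n :=
  if n is n'.+1 then compositions_from 1 n' else [:: [::]].

Lemma mem_compositions_from p n c : (0 < p)%N ->
  (c \in compositions_from p n) =
  [&& all (leq 1) c, sumn c == (p + n)%N & (p <= head 0 c)%N].
Proof.
elim: n p c => [|n IH] p c p_gt0 /=.
  rewrite inE addn0; case: c => [|a [|b c]] /=.
  - by rewrite leqn0 eqn0Ngt p_gt0 !andbF.
  - by rewrite eqseq_cons eqxx !andbT addn0; lia.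
  - by rewrite eqseq_cons andbF; lia.
rewrite mem_cat IH // addSnnS.
case: c => [|a c] /=; first by rewrite [X in _ || X](introF mapP) => [|[]//]; lia.
have -> : (a :: c \in [seq p :: i | i <- compositions_from 1 n]) =
          (a == p) && (c \in compositions_from 1 n).
  apply/mapP/andP => [[c' c'in [-> ->]]|[/eqP-> cin]]; last by exists c.
  by rewrite eqxx.
rewrite IH //; case: c => [|b c] /=; first by rewrite andbT; lia.
by case: (all _ c); lia.
Qed.

Lemma uniq_compositions_from p n : (0 < p)%N -> uniq (compositions_from p n).
Proof.
elim: n p => //= n IH p p_gt0.
rewrite cat_uniq IH // map_inj_uniq; last by move=> ? ? [].
rewrite IH // andbT /=; apply/hasPn => _ /mapP[c _ ->] /=.
by rewrite mem_compositions_from //= ltnn !andbF.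
Qed.

Lemma mem_compositions n c :
  (c \in compositions n) = all (leq 1) c && (sumn c == n).
Proof.
case: n => [|n] /=; last first.
  rewrite mem_compositions_from // add1n.
  by case: c => //= -[|a] c; rewrite /= ?andbT.
by rewrite inE; case: c => //= -[|a] c; rewrite //= addSn andbF.
Qed.

Lemma uniq_compositions n : uniq (compositions n).
Proof. by case: n => //= n; apply: uniq_compositions_from. Qed.

(** Both index sets are duplicate-free and describe the lists of positive
    integers of sum n: the length and the entries of such a list are at most n,
    so the bounds on the left lose nothing. *)
Lemma sum_compositions (V : nmodType) (F : seq nat -> V) n :
  \sum_(l < n.+1)
    \sum_(k : l.-tuple 'I_n.+1 |
            all (leq 1) (map val k) && (sumn (map val k) == n))
      F (map val k) =
  \sum_(c <- compositions n) F c.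
Proof.
pose cond (k : seq 'I_n.+1) :=
  all (leq 1) (map val k) && (sumn (map val k) == n).
pose tuples l := [seq k : l.-tuple _ <- enum {: l.-tuple 'I_n.+1} | cond k].
pose parts l (k : l.-tuple 'I_n.+1) := map val k.
pose L := [seq parts _ k | l <- enum 'I_n.+1, k <- tuples (val l)].
transitivity (\sum_(c <- L) F c).
  rewrite big_flatten big_map big_enum; apply: eq_bigr => l _.
  by rewrite big_map big_filter big_enum_cond.
apply: perm_big; apply: uniq_perm; last 1 first.
- move=> c; rewrite mem_compositions.
  apply/flattenP/andP => [[s /mapP[l _ ->] /mapP[k]]|[c_gt0 /eqP sum_c]].
    by rewrite mem_filter => /andP[/andP[? ?] _] ->.
  have c_le : (size c <= n)%N.
    rewrite -sum_c; elim: c c_gt0 {sum_c} => //= a c IH /andP[a_gt0 /IH]; lia.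
  have c_lt : all (fun a => a < n.+1)%N c.
    apply/allP => a; rewrite -sum_c ltnS; elim: (c) => //= b d IH.
    rewrite inE => /orP[/eqP->|/IH]; lia.
  have def_c : map val (map (@inord n) c) = c.
    rewrite -map_comp map_id_in // => a /(allP c_lt) /= lt_a; exact: inordK.
  have lt_c : (size c < n.+1)%N by [].
  exists [seq parts _ k | k <- tuples (Ordinal lt_c)].
    by apply/mapP; exists (Ordinal lt_c) => //; rewrite ?mem_enum.
  have sz : size (map (@inord n) c) == size c by rewrite size_map.
  apply/mapP; exists (Tuple sz) => //=.
  by rewrite mem_filter mem_enum /cond /= def_c c_gt0 sum_c eqxx.
- rewrite /L; apply: allpairs_uniq_dep => /= [|l _|].
  + exact: enum_uniq.
  + by rewrite filter_uniq // enum_uniq.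
  + move=> [l1 k1] [l2 k2] _ _ /= eq_k.
    have eq_l : l1 = l2.
      apply/val_inj; move/(congr1 size): eq_k.
      by rewrite /parts !size_map !size_tuple.
    case: l2 / eq_l k2 eq_k => k2 eq_k; congr Tagged.
    by apply: val_inj; apply: (inj_map val_inj).
- exact: uniq_compositions.
Qed.

Lemma blocksum_from_compositions (T U : Type) (V : nmodType)
    (f : seq U -> V) (g : seq T -> U) p t :
  blocksum_from f g p t =
  \sum_(c <- compositions_from (size p) (size t)) f (map g (reshape c (p ++ t))).
Proof.
elim: t f p => [|x t IH] f p /=.
  by rewrite big_seq1 /= cats0 take_size.
rewrite big_cat big_map /= !IH size_rcons cat_rcons; congr (_ + _).
by apply: eq_bigr => c _; rewrite take_size_cat // drop_size_cat.
Qed.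

Lemma blocksum_compositions (T U : Type) (V : nmodType)
    (f : seq U -> V) (g : seq T -> U) s :
  blocksum f g s = \sum_(c <- compositions (size s)) f (map g (reshape c s)).
Proof.
case: s => [|x t]; first by rewrite big_seq1.
exact: blocksum_from_compositions.
Qed.

End Sums.

(** * Multilinear functions on lists, and solving for inverses *)

Section Multilinear.

Variables (K : fieldType) (B : algType K).
Implicit Types (phi psi : B -> B) (f g h : seq B -> B) (s t p : seq B).

Lemma eq_linear phi psi : phi =1 psi -> linear phi -> linear psi.
Proof. by move=> eq_phi lin a u v; rewrite -!eq_phi lin. Qed.

Lemma linear_cst0 : linear (fun _ : B => 0 : B).
Proof. by move=> a u v; rewrite /= scaler0 addr0. Qed.

Lemma linear_add phi psi :
  linear phi -> linear psi -> linear (fun y => phi y + psi y).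
Proof. by move=> lphi lpsi a u v; rewrite lphi lpsi scalerDr addrACA. Qed.

Lemma linear_opp phi : linear phi -> linear (fun y => - phi y).
Proof. by move=> lphi a u v; rewrite lphi opprD scalerN. Qed.

Lemma linear_comp phi psi :
  linear phi -> linear psi -> linear (fun y => phi (psi y)).
Proof. by move=> lphi lpsi a u v; rewrite lpsi lphi. Qed.

Lemma linear_mull (c : B) phi : linear phi -> linear (fun y => c * phi y).
Proof. by move=> lphi a u v; rewrite lphi mulrDr scalerAr. Qed.

Lemma linear_mulr (c : B) phi : linear phi -> linear (fun y => phi y * c).
Proof. by move=> lphi a u v; rewrite lphi mulrDl scalerAl. Qed.

Lemma linear_morphD phi : linear phi -> {morph phi : a b / a + b}.
Proof. by move=> lphi a b; rewrite -[a]scale1r lphi !scale1r. Qed.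

Lemma linear_0 phi : linear phi -> phi 0 = 0.
Proof.
move=> lphi; rewrite -[X in phi X](subrr (0 : B)) -scaleN1r addrC lphi.
by rewrite scaleN1r addNr.
Qed.

Lemma linear_inverse phi psi :
  linear phi -> cancel phi psi -> cancel psi phi -> linear psi.
Proof.
by move=> lphi phiK psiK a u v; rewrite -{1}[u]psiK -{1}[v]psiK -lphi phiK.
Qed.

Lemma linear_splitsum (P : B -> seq B -> seq B -> B) s :
  (forall u v, linear (fun y => P y u v)) ->
  linear (fun y => splitsum (P y) s).
Proof.
elim: s P => [|x s IH] P linP; first exact: linP.
by apply: linear_add (linP _ _) _; apply: IH => u v; apply: linP.
Qed.

Lemma linear_blocksum_from (f : B -> seq B -> B) g p t :
  (forall w, linear (fun y => f y w)) ->
  linear (fun y => blocksum_from (f y) g p t).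
Proof.
elim: t f p => [|x t IH] f p linf; first exact: linf.
by apply: linear_add; apply: IH => // w; apply: linf.
Qed.

Definition mlin f := forall s1 s2, linear (fun y => f (s1 ++ y :: s2)).

Lemma mlin_cons f b : mlin f -> mlin (fun w => f (b :: w)).
Proof. by move=> linf s1; apply: (linf (b :: s1)). Qed.

Lemma mlin0 : mlin (fun _ => 0).
Proof. by move=> s1 s2; apply: linear_cst0. Qed.

Lemma mlinB f g : mlin f -> mlin g -> mlin (fun s => f s - g s).
Proof.
by move=> linf ling s1 s2; apply: linear_add (linf _ _) _; apply: linear_opp.
Qed.

Lemma mlin_comp phi f : linear phi -> mlin f -> mlin (fun s => phi (f s)).
Proof. by move=> lphi linf s1 s2; apply: linear_comp. Qed.

Lemma mlin_splitsum f g :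
  mlin f -> mlin g -> mlin (splitsum (fun u v => f u * g v)).
Proof.
move=> linf ling s1 s2.
apply: eq_linear => [y|]; first by rewrite splitsum_cat_cons.
apply: linear_add; apply: linear_splitsum => u v.
  exact: linear_mull.
exact: linear_mulr.
Qed.

Lemma mlin_blocksum f g : mlin f -> mlin g -> mlin (blocksum f g).
Proof.
move=> linf ling.
have lin_p f0 p q t : mlin f0 ->
    linear (fun y => blocksum_from f0 g (p ++ y :: q) t).
  elim: t f0 p q => [|x t IH] f0 p q linf0.
    exact: linear_comp (linf0 [::] [::]) (ling p q).
  apply: linear_add.
    by apply: eq_linear (IH _ p (rcons q x) linf0) => y; rewrite rcons_cat.
  apply: linear_blocksum_from => w.
  exact: linear_comp (linf0 [::] w) (ling p q).
have lin_t f0 p s1 s2 : mlin f0 ->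
    linear (fun y => blocksum_from f0 g p (s1 ++ y :: s2)).
  elim: s1 f0 p => [|x s1 IH] f0 p linf0; apply: linear_add.
  - by apply: eq_linear (lin_p f0 p [::] s2 linf0) => y; rewrite cats1.
  - exact: (lin_p _ [::] [::]) (mlin_cons _ linf0).
  - exact: IH.
  - exact: IH (mlin_cons _ linf0).
move=> [|x s1] s2; last exact: lin_t.
exact: (lin_p f [::] [::]).
Qed.

(** The iterates of Phi from 0 are multilinear, and the value at s is constant
    from the iterate of rank size s + 1 on.  Lists obtained by changing one
    argument have the same size, so multilinearity passes to the limit. *)
Lemma mlin_fixpoint (Phi : (seq B -> B) -> seq B -> B) :
  (forall h, mlin h -> mlin (Phi h)) ->
  (forall h h' s, (forall t, (size t < size s)%N -> h t = h' t) ->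
     Phi h s = Phi h' s) ->
  exists2 h, mlin h & h =1 Phi h.
Proof.
move=> Phi_lin Phi_loc; pose it n := iter n Phi (fun _ => 0).
have it_lin n : mlin (it n) by elim: n => [|n /Phi_lin //]; apply: mlin0.
have it_eq n m s : (size s < n)%N -> (size s < m)%N -> it n s = it m s.
  elim: n m s => // n IH [|m] s //= s_n s_m.
  by apply: Phi_loc => t t_s; apply: IH; lia.
exists (fun s => it (size s).+1 s) => [s1 s2|s].
  apply: eq_linear (it_lin (size s1 + size s2).+2 s1 s2) => y.
  by rewrite size_cat addnS.
by apply: Phi_loc => t t_s; apply: it_eq.
Qed.

Lemma mlin_head : mlin (fun s => if size s == 1%N then head 0 s else 0).
Proof.
move=> [|x [|y s1]] s2; try exact: linear_cst0.
by case: s2 => [|y s2] a u v //=; rewrite scaler0 addr0.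
Qed.

Lemma splitsum_mul1l f s :
  splitsum (fun u v => (size u == 0%N)%:R * f v) s = f s.
Proof.
case: s => [|x t] /=; rewrite mul1r // (eq_splitsum (Q := fun _ _ => 0)).
  rewrite [X in _ + X](_ : _ = 0) ?addr0 //.
  by elim: t => //= y t ->; rewrite addr0.
by move=> u v _; rewrite mul0r.
Qed.

Lemma splitsum_mul1r f s :
  splitsum (fun u v => f u * (size v == 0%N)%:R) s = f s.
Proof.
elim: s f => [|x t IH] f /=; first by rewrite mulr1.
by rewrite mulr0 add0r (IH (fun u => f (x :: u))).
Qed.

(** A block of length at least two puts an argument 0 into f, so only the
    segmentation into singletons contributes. *)
Lemma blocksum_head f s :
  mlin f -> blocksum f (fun t => if size t == 1%N then head 0 t else 0) s = f s.
Proof.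
case: s => [|x t] //= linf.
have kill f0 p u : mlin f0 -> (1 < size p)%N ->
    blocksum_from f0 (fun t => if size t == 1%N then head 0 t else 0) p u = 0.
  elim: u p => [|y u IH] p linf0 p_gt1 /=; rewrite gtn_eqF //.
    exact: linear_0 (linf0 [::] [::]).
  rewrite IH ?size_rcons ?(leqW p_gt1) // add0r blocksum_from0 // => b w.
  exact: linear_0 (linf0 [::] (b :: w)).
elim: t f x linf => [|y t IH] f x linf //=.
by rewrite kill // add0r IH //; apply: mlin_cons.
Qed.

Definition nonempty_part f s := if s is [::] then 0 else f s.
Definition nonlinear_part f s := if s is [:: _] then 0 else f s.

Lemma mlin_nonempty_part f : mlin f -> mlin (nonempty_part f).
Proof. by move=> linf [|x s1] s2; apply: linf. Qed.

Lemma mlin_nonlinear_part f : mlin f -> mlin (nonlinear_part f).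
Proof.
move=> linf [|x [|y s1]] s2; try exact: linf.
by case: s2 => [|z s2]; [apply: linear_cst0 | apply: linf].
Qed.

Lemma splitsum_nonempty f g s :
  splitsum (fun u v => f u * g v) s =
  f [::] * g s + splitsum (fun u v => nonempty_part f u * g v) s.
Proof. by case: s => [|x t] /=; rewrite mul0r ?addr0 ?add0r. Qed.

(** Isolates the only segmentation that involves g on the whole list; the
    two hypotheses deal with the empty list, which has no one-block
    segmentation. *)
Lemma blocksum_nonlinear f g s : f [:: 0] = 0 -> g [::] = 0 ->
  blocksum f g s = f [:: g s] + blocksum (nonlinear_part f) g s.
Proof.
case: s => [|x t] f0 g0 /=; first by rewrite g0 f0 add0r.
pose f1 w := if w is [:: _] then f w else 0.
rewrite (@eq_blocksum_from _ _ _ _ (fun w => f1 w + nonlinear_part f w)).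
  by rewrite blocksum_fromD blocksum_from1.
by move=> b [|c w] /=; rewrite ?addr0 ?add0r.
Qed.

(** Solves f ⋅ h = 1 degree by degree: h s = c (1 s - (f - f_0) ⋅ h) s, whose
    right-hand side involves h on proper suffixes of s only. *)
Lemma splitsum_rinv f c :
  mlin f -> f [::] * c = 1 ->
  exists2 h, mlin h &
    forall s, splitsum (fun u v => f u * h v) s = (size s == 0%N)%:R.
Proof.
move=> linf fc.
have lin1 : mlin (fun s => (size s == 0%N)%:R).
  by move=> [|x s1] s2; apply: linear_cst0.
case: (@mlin_fixpoint (fun h s => c * ((size s == 0%N)%:R -
    splitsum (fun u v => nonempty_part f u * h v) s))).
- move=> h linh; apply: (mlin_comp (phi := fun y => c * y)).
    by apply: linear_mull => a u v.
  by apply: mlinB => //; apply: mlin_splitsum => //; apply: mlin_nonempty_part.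
- move=> h h' s hh'; congr (_ * (_ - _)); apply: eq_splitsum => u v def_s.
  case: u def_s => [|x u] def_s; first by rewrite !mul0r.
  by rewrite hh' // def_s /= size_cat; lia.
- move=> h linh def_h; exists h => // s.
  by rewrite splitsum_nonempty {1}def_h mulrA fc mul1r subrK.
Qed.

(** Solves f ∘ h = I degree by degree: h s = f_1^-1 (I s - (f - f_1) ∘ h) s,
    whose right-hand side involves h on lists shorter than s only. *)
Lemma blocksum_rinv f c :
  mlin f -> f [::] = 0 ->
  cancel (fun u => f [:: u]) c -> cancel c (fun u => f [:: u]) ->
  exists h, [/\ mlin h, h [::] = 0, forall x, h [:: x] = c x &
    forall s, blocksum f h s = if size s == 1%N then head 0 s else 0].
Proof.
move=> linf f0 fK cK.
have lin_f1 : linear (fun u => f [:: u]) by apply: (linf [::] [::]).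
have lin_c := linear_inverse lin_f1 fK cK.
case: (@mlin_fixpoint (fun h s => c ((if size s == 1%N then head 0 s else 0) -
    blocksum (nonlinear_part f) h s))).
- move=> h linh; apply: mlin_comp => //.
  apply: mlinB; [exact: mlin_head | apply: mlin_blocksum => //].
  exact: mlin_nonlinear_part.
- move=> h h' [|x t] hh' //; congr (c (_ - _)).
  exact: eq_blocksum_fromr_lt.
- move=> h linh def_h; exists h.
  have h0 : h [::] = 0 by rewrite def_h /= f0 subrr linear_0.
  split=> // [x|s]; first by rewrite def_h /= subr0.
  by rewrite blocksum_nonlinear ?(linear_0 lin_f1) // {1}def_h cK subrK.
Qed.

End Multilinear.

(** * The two groups of multilinear families *)

Section Groups.
Local Open Scope mult_scope.

Variables (K : fieldType) (B : algType K).
Implicit Types (f g h : multfam B) (s : seq B).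

Definition family_of (phi : seq B -> B) : multfam B := fun n x => phi x.

Lemma evE f n (x : n.-tuple B) : f n x = ev f x.
Proof.
case: x => s sz_s; have def_n := eqP sz_s; case: n / def_n sz_s => sz_s.
by rewrite /ev; congr (f _); apply: val_inj.
Qed.

Lemma multfam_ext f g : ev f =1 ev g -> f = g.
Proof.
move=> fg; apply: functional_extensionality_dep => n.
by apply: functional_extensionality_dep => x; rewrite !evE.
Qed.

Lemma ev_mmul f g s :
  ev (f ⋅ g) s = splitsum (fun u v => ev f u * ev g v) s.
Proof. exact: splitsumE. Qed.

Lemma ev_mcomp f g s : ev (f ∘ g) s = blocksum (ev f) (ev g) s.
Proof.
rewrite blocksum_compositions.
exact: (sum_compositions (fun c => ev f (map (ev g) (reshape c s)))).
Qed.

Lemma val_upd n (x : n.-tuple B) (i : 'I_n) u :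
  val (upd x i u) = take i x ++ u :: drop i.+1 x.
Proof.
have lt_i : (i < size x)%N by rewrite size_tuple.
apply: (@eq_from_nth _ 0) => [|j].
  rewrite size_tuple size_cat /= size_take size_drop lt_i size_tuple.
  by have := ltn_ord i; lia.
rewrite size_tuple => lt_j.
rewrite -[j]/(val (Ordinal lt_j)) -tnth_nth tnth_mktuple.
rewrite nth_cat size_take lt_i /= (tnth_nth 0) /=.
case: (ltngtP j i) => [lt_ji|lt_ij|eq_ji].
- by rewrite nth_take // -val_eqE /= ltn_eqF.
- rewrite -val_eqE /= gtn_eqF //; have -> : (j - i = (j - i.+1).+1)%N by lia.
  by rewrite /= nth_drop subnKC.
- by rewrite -val_eqE /= eq_ji eqxx subnn.
Qed.

Lemma is_multP f : is_mult f <-> mlin (ev f).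
Proof.
split=> linf.
  move=> s1 s2.
  have lt_i : (size s1 < size (s1 ++ 0%R :: s2))%N by rewrite size_cat /=; lia.
  apply: eq_linear (linf _ (in_tuple (s1 ++ 0 :: s2)) (Ordinal lt_i)) => u.
  rewrite evE val_upd /= take_size_cat // drop_cat ltnNge leqnSn /=.
  by rewrite subSnn /= drop0.
move=> n x i; apply: eq_linear (linf (take i x) (drop i.+1 x)) => u.
by rewrite evE val_upd.
Qed.

Lemma mmulA f g h : f ⋅ (g ⋅ h) = f ⋅ g ⋅ h.
Proof.
apply: multfam_ext => s; rewrite !ev_mmul.
transitivity (splitsum (fun u v =>
  splitsum (fun v1 v2 => ev f u * (ev g v1 * ev h v2)) v) s).
  apply: eq_splitsum => u v _.
  rewrite ev_mmul (splitsum_morph (phi := fun y => ev f u * y)) //.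
  exact: mulrDr.
rewrite -splitsumA; apply: eq_splitsum => u v _.
rewrite ev_mmul (splitsum_morph (phi := fun y => y * ev h v)).
  by apply: eq_splitsum => ? ? _; rewrite mulrA.
by move=> a b; rewrite mulrDl.
Qed.

Lemma mmul1f f : munit ⋅ f = f.
Proof. by apply: multfam_ext => s; rewrite ev_mmul splitsum_mul1l. Qed.

Lemma mmulf1 f : f ⋅ munit = f.
Proof. by apply: multfam_ext => s; rewrite ev_mmul splitsum_mul1r. Qed.

Lemma mcompA f g h : is_mult f -> f ∘ (g ∘ h) = (f ∘ g) ∘ h.
Proof.
move=> /is_multP linf; apply: multfam_ext => s; rewrite !ev_mcomp.
have -> : ev (f ∘ g) = blocksum (ev f) (ev g).
  by apply: functional_extensionality_dep => t; apply: ev_mcomp.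
have -> : ev (g ∘ h) = blocksum (ev g) (ev h).
  by apply: functional_extensionality_dep => t; apply: ev_mcomp.
by rewrite blocksumA // => s1 s2; apply: linear_morphD (linf s1 s2).
Qed.

Lemma mcomp_mmul f g h : (f ⋅ g) ∘ h = (f ∘ h) ⋅ (g ∘ h).
Proof.
apply: multfam_ext => s; rewrite ev_mmul ev_mcomp.
rewrite (eq_blocksum (f' := splitsum (fun u v => ev f u * ev g v))); last first.
  exact: ev_mmul.
rewrite blocksum_splitsum; apply: eq_splitsum => u v _.
rewrite !ev_mcomp (blocksum_morph (phi := fun y => y * _)); last first.
  by move=> a b; rewrite mulrDl.
apply: eq_blocksum => w; rewrite (blocksum_morph (phi := fun y => ev f w * y)) //.
exact: mulrDr.
Qed.

Lemma mcomp_Idl h : ev h [::] = 0 -> Id ∘ h = h.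
Proof.
move=> h0; apply: multfam_ext => -[|x t]; rewrite ev_mcomp ?h0 //.
exact: blocksum_from1.
Qed.

Lemma mcomp_Idr f : is_mult f -> f ∘ Id = f.
Proof.
move=> /is_multP linf; apply: multfam_ext => s.
rewrite ev_mcomp; exact: blocksum_head.
Qed.

Lemma mmul_rinv f : Ginv f -> exists2 h, Ginv h & f ⋅ h = munit.
Proof.
case=> /is_multP linf [c [cf fc]]; have [h linh fh] := splitsum_rinv linf fc.
exists (family_of h); last by apply: multfam_ext => s; rewrite ev_mmul; apply: fh.
split; first by apply/is_multP.
have fh0 : ev f [::] * h [::] = 1 by apply: (fh [::]).
have hc : h [::] = c by rewrite -[LHS]mul1r -cf -mulrA fh0 mulr1.
by exists (ev f [::]); rewrite [ev (family_of h) _]hc.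
Qed.

(** If f ⋅ h = 1 and h ⋅ h' = 1, then h ⋅ f = h ⋅ f ⋅ (h ⋅ h') = h ⋅ h' = 1. *)
Lemma mmul_invP f :
  Ginv f -> [/\ Ginv f^⋅-1, f ⋅ f^⋅-1 = munit & f^⋅-1 ⋅ f = munit].
Proof.
move=> finv; apply: (epsilon_spec (inhabits munit)
  (fun h => [/\ Ginv h, f ⋅ h = munit & h ⋅ f = munit])).
have [h hinv fh] := mmul_rinv finv.
have [h' _ hh'] := mmul_rinv hinv; exists h; split=> //.
by rewrite -[f]mmulf1 -hh' [f ⋅ _]mmulA fh mmul1f.
Qed.

Lemma mcomp_rinv f : Gdif f -> exists2 h, Gdif h & f ∘ h = Id.
Proof.
case=> /is_multP linf f0 [c fK cK].
have [h [linh h0 h1 fh]] := blocksum_rinv linf f0 fK cK.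
exists (family_of h); last by apply: multfam_ext => s; rewrite ev_mcomp; apply: fh.
split=> //; first by apply/is_multP.
by apply: (@eq_bij _ _ c); [exists (fun u => ev f [:: u]) | move=> u; rewrite -h1].
Qed.

Lemma mcomp_invP f :
  Gdif f -> [/\ Gdif f^∘-1, f ∘ f^∘-1 = Id & f^∘-1 ∘ f = Id].
Proof.
move=> fdif; apply: (epsilon_spec (inhabits Id)
  (fun h => [/\ Gdif h, f ∘ h = Id & h ∘ f = Id])).
have [h hdif fh] := mcomp_rinv fdif.
have [h' [_ h'0 _] hh'] := mcomp_rinv hdif; exists h; split=> //.
have [multf _ _] := fdif; have [multh _ _] := hdif.
by rewrite -[f]mcomp_Idr // -hh' [f ∘ _]mcompA // fh mcomp_Idl.
Qed.

Lemma ev_mmul0 f g : ev (f ⋅ g) [::] = ev f [::] * ev g [::].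
Proof. by rewrite ev_mmul. Qed.

Lemma is_mult_mmul f g : is_mult f -> is_mult g -> is_mult (f ⋅ g).
Proof.
move=> /is_multP linf /is_multP ling; apply/is_multP => s1 s2.
by apply: eq_linear (mlin_splitsum linf ling s1 s2) => y; rewrite ev_mmul.
Qed.

Lemma is_mult_Id : is_mult (Id : multfam B).
Proof. apply/is_multP; exact: mlin_head. Qed.

Lemma Gdif_Id_mmul f : Ginv f -> Gdif (Id ⋅ f).
Proof.
case=> multf [c [cf fc]]; split.
- exact: is_mult_mmul is_mult_Id multf.
- by rewrite ev_mmul0 mul0r.
- apply: (@eq_bij _ _ (fun u => u * ev f [::])).
    by exists (fun u => u * c) => u; rewrite -mulrA ?fc ?cf mulr1.
  by move=> u; rewrite ev_mmul /= /ev /Id /= mul0r add0r.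
Qed.

Lemma Gdif_mmul_Id f : Ginv f -> Gdif (f ⋅ Id).
Proof.
case=> multf [c [cf fc]]; split.
- exact: is_mult_mmul multf is_mult_Id.
- by rewrite ev_mmul0 mulr0.
- apply: (@eq_bij _ _ (fun u => ev f [::] * u)).
    by exists (fun u => c * u) => u; rewrite mulrA ?fc ?cf mul1r.
  by move=> u; rewrite ev_mmul /= /ev /Id /= mulr0 addr0.
Qed.

(** The only property of the antipode S^l that the factorization uses. *)
Lemma Sl_mcomp f : Ginv f -> Sl f ∘ (Id ⋅ f) = f^⋅-1.
Proof.
move=> finv; have [[multV _] _ _] := mmul_invP finv.
have [_ _ VK] := mcomp_invP (Gdif_Id_mmul finv).
by rewrite /Sl -mcompA // VK mcomp_Idr.
Qed.

Lemma Sr_mcomp f : Ginv f -> Sr f ∘ (f ⋅ Id) = f^⋅-1.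
Proof.
move=> finv; have [[multV _] _ _] := mmul_invP finv.
have [_ _ VK] := mcomp_invP (Gdif_mmul_Id finv).
by rewrite /Sr -mcompA // VK mcomp_Idr.
Qed.

Lemma rhd_factor f g : Ginv f -> is_mult g -> rhd f g = rhd_l f (rhd_r (Sl f) g).
Proof.
move=> finv multg; have [_ Idf0 _] := Gdif_Id_mmul finv.
by rewrite /rhd_l /rhd_r -mcompA // mcomp_mmul Sl_mcomp // mcomp_Idl // mmulA.
Qed.

Lemma rhd'_factor f g : Ginv f -> is_mult g -> rhd' f g = rhd_r f (rhd_l (Sr f) g).
Proof.
move=> finv multg; have [_ fId0 _] := Gdif_mmul_Id finv.
by rewrite /rhd_l /rhd_r -mcompA // mcomp_mmul Sr_mcomp // mcomp_Idl.
Qed.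

End Groups.

Theorem proposition3p18 (K : fieldType) (charK : [pchar K] =i pred0)
    (B : algType K) (F G : multfam B) (hF : Ginv F) (hG : Ginv G) :
  [/\ rhd F G = rhd_l F (rhd_r (Sl F) G),
      rhd' F G = rhd_r F (rhd_l (Sr F) G),
      bullet F G = star_l (rhd_r (Sl G) F) G &
      bullet' F G = star_r (rhd_l (Sr G) F) G].
Proof.
have [[multF _] [multG _]] := (hF, hG); split.
- exact: rhd_factor.
- exact: rhd'_factor.
- by rewrite /bullet -/(rhd G F) rhd_factor.
- by rewrite /bullet' -/(rhd' G F) rhd'_factor.
Qed.
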